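(* Let $h\ge 0$ and let $(G,D)$ be a finite $3$-transposition group of type $3^{\bullet 2h}{:}(2\times \operatorname{SU}_{5}(2))$. Then the diagram of $(G,D)$ has size $n=165\cdot 3^{2h}$ and spectrum $$((\,129\cdot 3^{2h}-1;\ [3^{2h+2}-1]^{44},\ [-3^{2h+1}-1]^{120},\ [-1]^{\star}\,)).$$
   Context: A $3$-transposition group $(G,D)$ is a group $G$ generated by a conjugacy class $D$ of elements of order $2$ such that $|de|\in\{1,2,3\}$ for all $d,e\in D$. Its diagram is the graph with vertex set $D$ in which two elements are adjacent iff their product has order $3$; its size is $n=|D|$. The spectrum is that of the $(0,1)$-adjacency matrix, written $((k;\dots,[r]^c,\dots))$: first the degree $k$ of the (regular) diagram, counted once, then the remaining eigenvalues, $[r]^c$ meaning $r$ with multiplicity $c$; if listed values coincide, their multiplicities are added, and $[r]^\star$ means that $r$ has whatever further multiplicity (possibly zero) is required for the total multiplicity to be $n$. $\operatorname{SU}_5(2)$ is the special unitary group of a nondegenerate hermitian form $f$ on $\mathbb{F}_4^5$, generated by the unitary transvections $t_v: x\mapsto x+f(x,v)v$ with $v\neq 0$ isotropic. $2\times\operatorname{SU}_5(2)$, with the group of order $2$ generated by $z$, is taken with the $3$-transposition class $E=\{(z,t_v)\}$. $(G,D)$ has type $3^{\bullet 2h}{:}(2\times\operatorname{SU}_5(2))$ if $G$ has a normal $3$-subgroup $N$ with $|D\cap dN|=3^{2h}$ for all $d\in D$ and $(G/N,DN/N)\cong(2\times\operatorname{SU}_5(2),E)$. *)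

(* Defs.v *)
From HB Require Import structures.
From mathcomp Require Import all_boot all_order all_fingroup all_algebra.
From mathcomp Require Import all_solvable all_field.
From mathcomp Require Import sesquilinear.

Set Implicit Arguments.
Unset Strict Implicit.
Unset Printing Implicit Defensive.

Import Order.TTheory GRing.Theory Num.Theory.
Import GroupScope.
Local Open Scope ring_scope.

Section ThreeTranspositions.
Variable gT : finGroupType.
Implicit Types (G N : {group gT}) (D : {set gT}).

Definition three_transposition_group G D : Prop :=
  [/\ D \in classes G,
      <<D>>%g = G,
      forall d, d \in D -> #[d]%g = 2%N
    & forall d e, d \in D -> e \in D -> #[(d * e)%g] \in [:: 1; 2; 3]%N].

Definition adjacent : rel gT := fun d e => #[(d * e)%g] == 3%N.

Definition adjacency_matrix D : 'M[algC]_#|D| :=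
  \matrix_(i, j) (adjacent (enum_val i) (enum_val j))%:R.

End ThreeTranspositions.

(* The eigenvalues of A, listed with multiplicity as the roots of the         *)
(* characteristic polynomial; the order of the list is irrelevant.            *)
Definition spectrum n (A : 'M[algC]_n) : seq algC :=
  sval (closed_field_poly_normal (char_poly A)).

Lemma spectrumE n (A : 'M[algC]_n) :
  char_poly A = \prod_(r <- spectrum A) ('X - r%:P).
Proof.
rewrite /spectrum; case: closed_field_poly_normal => r /= {1}->.
by rewrite (monicP (char_poly_monic A)) scale1r.
Qed.

(* has_diagram_spectrum D k s r reads ((k; [x]^c, ..., [r]^star)), where s lists *)
(* the pairs (x, c). Lists are compared up to permutation, so coinciding      *)
(* values accumulate, and m is forced by the total size #|D|.                 *)
Definition has_diagram_spectrum (gT : finGroupType) (D : {set gT})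
    (k : nat) (s : seq (algC * nat)) (r : algC) : Prop :=
  (forall d, d \in D -> #|[set e in D | adjacent d e]| = k) /\
  exists m : nat, perm_eq (spectrum (adjacency_matrix D))
    (k%:R :: flatten [seq nseq xc.2 xc.1 | xc <- s] ++ nseq m r).

Section SpecialUnitary.
Variables (F : finFieldType) (theta : {rmorphism F -> F}).
Variable f : {hermitian 'rV[F]_5 for false & theta}.

(* Matrices act on row vectors from the right. *)
Definition SU5 : {set {'GL_5[F]}} :=
  [set g : {'GL_5[F]} | (\det (GLval g) == 1) &&
    [forall u : 'rV[F]_5, forall v : 'rV[F]_5,
       f (u *m GLval g) (v *m GLval g) == f u v]].

Lemma SU5_group_set : group_set SU5.
Proof.
apply/group_setP; split=> [|g k].
  rewrite inE det1 eqxx /=; apply/forallP=> u; apply/forallP=> v.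
  by rewrite !mulmx1.
rewrite !inE => /andP[/eqP dg /forallP ig] /andP[/eqP dk /forallP ik].
rewrite det_mulmx dg dk mulr1 eqxx /=; apply/forallP=> u; apply/forallP=> v.
rewrite !mulmxA (eqP (forallP (ik _) _)).
exact: (forallP (ig u)).
Qed.
Canonical SU5_group := Group SU5_group_set.

Definition is_transvection (g : {'GL_5[F]}) (v : 'rV[F]_5) : bool :=
  [forall x : 'rV[F]_5, x *m GLval g == x + f x v *: v].

(* 2 x SU_5: the group of order 2 is the additive group 'Z_2, with z = Zp1. *)
Definition two_x_SU5 : {group 'Z_2 * {'GL_5[F]}} :=
  setX_group [group of [set: 'Z_2]] SU5_group.

Definition two_x_SU5_class : {set 'Z_2 * {'GL_5[F]}} :=
  [set zt | (zt.1 == Zp1) &&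
    [exists v : 'rV[F]_5,
       [&& v != 0, f v v == 0 & is_transvection zt.2 v]]].

(* (G, D) has type 3^{. 2h} : (2 x SU_5(2)), with SU_5(2) that of f. *)
Definition type_3_2h_2xSU5 (gT : finGroupType) (G : {group gT})
    (D : {set gT}) (h : nat) : Prop :=
  exists N : {group gT},
    [/\ N <| G, 3.-group N,
        forall d, d \in D -> #|D :&: (d *: N)%g| = (3 ^ (2 * h))%N
      & exists phi : {morphism (G / N)%g >-> 'Z_2 * {'GL_5[F]}},
          isom (G / N) two_x_SU5 phi /\
          phi @* (D / N) = two_x_SU5_class]%g.

End SpecialUnitary.

Lemma card4_pchar (F : finFieldType) : #|F| = 4%N -> 2%N \in [pchar F].
Proof. by move=> cF; apply: (@card_finPcharP F 2 2). Qed.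

(* x |-> x ^+ 2, the involution of the field with 4 elements. *)
Definition conj4 (F : finFieldType) (cardF : #|F| = 4%N) : {rmorphism F -> F} :=
  pFrobenius_aut (card4_pchar cardF).

(* Main.v *)
Require Import Defs.
From HB Require Import structures.
From mathcomp Require Import all_boot all_order all_fingroup all_algebra.
From mathcomp Require Import all_solvable all_field.
From mathcomp Require Import sesquilinear.
From mathcomp Require Import zify ring.

Import Order.TTheory GRing.Theory Num.Theory.
Local Open Scope ring_scope.

(* Write q = 3^(2h). For d, e in D the product d e has order 1 or 3 when        *)
(* dN = eN, order 2 when the cosets are distinct and commute, and order 3       *)
(* otherwise. Hence B = A + I is constant on pairs of cosets: it is the q-fold  *)
(* blow-up of I + A0, where A0 is the non-orthogonality graph on the isotropic  *)
(* points of PG(4, 4). The Gauss sum of (-1)^f(x, x) has square 4^5, and        *)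
(* divisibility by 3 of the number of nonzero isotropic vectors makes it -32.   *)
(* Completing the square in this sum counts the isotropic vectors orthogonal    *)
(* to one or two given isotropic vectors, so that A0 is strongly regular with   *)
(* parameters (165, 128, 100, 96). It follows that                              *)
(*   B (B + 3q) (B - 9q) (B - 129q) = 0,                                        *)
(* so B is diagonalizable, and its trace and that of B^2 give the               *)
(* multiplicities.                                                              *)

(** * Spectra of annihilated matrices *)

(** The quotient by [N] only repeats each isotropic point [q] times. [adjacent_or_eq] shows that
    adjacency or equality in [D] is visible in [G / N], and [diagram_coordinates] translates this
    into the hermitian form: each element of [D] receives an isotropic vector, every isotropic point
    is hit [q] times, and two elements are adjacent or equal iff their vectors span the same point
    or are not orthogonal. The graph on the 165 points is then a matter of counting. [gauss_sumE]
    finds the number of isotropic vectors and [card_isotropic_nonortho] the common neighbours,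
    giving A0^2 = 32 I + 4 A0 + 96 J; hence I + A0 has eigenvalues 129, 9 and -3. The blow-up
    multiplies them by [q] and adds the eigenvalue 0. [blowup_spectrum] obtains the multiplicities
    from traces, and subtracting I gives the diagram. *)

Lemma eq_of_sub (V : zmodType) (a b c d : V) : c = d -> a - b = c - d -> a = b.
Proof. by move=> -> /eqP; rewrite subrr subr_eq0 => /eqP. Qed.
Arguments eq_of_sub {V a b c d}.

(** The minimal polynomial divides a product of distinct linear factors, so [A] is diagonalizable,
    and its eigenvalues, being roots of that polynomial, lie in [rs]. *)
Lemma diagonalize_annihilated n (A : 'M[algC]_n) (rs : seq algC) :
  uniq rs -> \big[mulmx/1%:M]_(r <- rs) (A - r%:M) = 0 ->
  exists P (d : 'rV_n), [/\ P \in unitmx, A = invmx P *m diag_mx d *m P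
    & forall i, d 0 i \in rs].
Proof.
(* The empty matrix is set apart, as [horner_mx] evaluates in the ring of matrices of positive
   size. *)
case: n A => [|n] A urs A0.
  exists 1%:M, 0; split; first exact: unitmx1; last by case.
  by apply/matrixP; case.
have min_rs : mxminpoly A %| \prod_(r <- rs) ('X - r%:P).
  apply: mxminpoly_min; rewrite rmorph_prod -[RHS]A0; apply: eq_bigr => r _.
  by rewrite rmorphB /= horner_mx_X horner_mx_C.
have /diagonalizableP[P uP /diagonalizable_forPex[d simA]] :
  exists2 rs, uniq rs & mxminpoly A %| \prod_(r <- rs) ('X - r%:P) by exists rs.
exists P, d; split=> // [|i]; first by rewrite -conjVmx //; apply/simmxLR.
rewrite -root_prod_XsubC -dvdp_XsubCl (dvdp_trans _ min_rs) // dvdp_XsubCl (simmx_minpoly uP simA).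
rewrite mxminpoly_diag root_prod_XsubC mem_undup.
by apply/mapP; exists i; rewrite ?mem_enum.
Qed.

Lemma spectrum_shift n (A P : 'M[algC]_n) (d : 'rV_n) c :
  P \in unitmx -> A = invmx P *m diag_mx d *m P ->
  perm_eq (spectrum (A - c%:M)) [seq d 0 i - c | i : 'I_n].
Proof.
move=> uP eA; apply: prod_XsubC_eq; rewrite -spectrumE big_map big_enum /=.
rewrite /char_poly.
have -> : char_poly_mx (A - c%:M) =
  map_mx polyC (invmx P) *m diag_mx (\row_i ('X - (d 0 i - c)%:P)) *m map_mx polyC P.
  have -> : diag_mx (\row_i ('X - (d 0 i - c)%:P)) =
    'X%:M - map_mx polyC (diag_mx d - c%:M).
    apply/matrixP=> i j; rewrite !mxE; case: eqP => [->|_].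
      by rewrite !mulr1n.
    by rewrite !mulr0n !subr0.
  have VP : map_mx polyC (invmx P) *m map_mx polyC P = 1%:M.
    by rewrite -map_mxM mulVmx // map_mx1.
  rewrite mulmxBr mulmxBl scalar_mxC -[_ *m _ *m map_mx _ P]mulmxA VP mulmx1.
  rewrite -!map_mxM /char_poly_mx; congr (_ - map_mx _ _).
  by rewrite mulmxBr mulmxBl -eA scalar_mxC -[_ *m _ *m P]mulmxA mulVmx // mulmx1.
rewrite !det_mulmx mulrAC -det_mulmx -map_mxM mulVmx // map_mx1 det1 mul1r det_diag.
by apply: eq_bigr => i _; rewrite mxE.
Qed.

Lemma mxtrace_diagonalized n (P : 'M[algC]_n) (d : 'rV_n) :
  P \in unitmx -> \tr (invmx P *m diag_mx d *m P) = \sum_i d 0 i.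
Proof. by move=> uP; rewrite mxtrace_mulC mulmxA mulmxV // mul1mx mxtrace_diag. Qed.

Lemma diagonalized_mulmx n (P : 'M[algC]_n) (d e : 'rV_n) :
  P \in unitmx ->
  (invmx P *m diag_mx d *m P) *m (invmx P *m diag_mx e *m P) =
    invmx P *m diag_mx (\row_i (d 0 i * e 0 i)) *m P.
Proof.
by move=> uP; rewrite !mulmxA mulmxK // -[_ *m diag_mx d *m _]mulmxA mulmx_diag.
Qed.

(** Grouping a list by its values turns eigenvalue lists into multiplicities. *)
Lemma perm_flatten_count (T : eqType) (rs s : seq T) :
  uniq rs -> {subset s <= rs} ->
  perm_eq s (flatten [seq nseq (count_mem r s) r | r <- rs]).
Proof.
move=> urs s_rs; apply/allP => x /=; rewrite mem_cat => xs.
have {xs} x_rs : x \in rs.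
  case/orP: xs => [/s_rs //|/flattenP[_ /mapP[r r_rs ->]]].
  by rewrite mem_nseq => /andP[_ /eqP ->].
rewrite count_flatten -map_comp sumnE big_map (bigD1_seq x) //= count_nseq /= eqxx.
rewrite mul1n big1 ?addn0 // => r /negPf rx.
by rewrite count_nseq /= rx.
Qed.

Lemma big_count (T : eqType) (rs s : seq T) (g : T -> algC) :
  uniq rs -> {subset s <= rs} ->
  \sum_(x <- s) g x = \sum_(r <- rs) (count_mem r s)%:R * g r.
Proof.
move=> urs /(perm_flatten_count _ _ _ urs) s_rs; rewrite (perm_big _ s_rs) /=.
rewrite big_flatten big_map; apply: eq_bigr => r _.
by rewrite big_nseq iter_addr addr0 mulr_natl.
Qed.

Lemma blowup_spectrum n (q : nat) (B S : 'M[algC]_n) (J := const_mx 1 : 'M[algC]_n) :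
  (0 < q)%N -> n = (165 * q)%N ->
  B *m B = q%:R *: (27 *: S + 6 *: B + 96 *: J) ->
  B *m S = q%:R *: B -> B *m J = (129 * q%:R) *: J ->
  \tr B = n%:R -> \tr S = n%:R ->
  perm_eq (spectrum (B - 1%:M))
    (129 * q%:R - 1 :: nseq 44 (9 * q%:R - 1) ++ nseq 120 (- 3 * q%:R - 1) ++
     nseq (165 * (q - 1)) (- 1)).
Proof.
move=> q0 nE BB BS BJ trB trS; set k : algC := q%:R in BB BS BJ *.
have k0 : k != 0 by rewrite pnatr_eq0 -lt0n.
(* One more factor [B] removes [S], because B S = k B; what remains involves only powers of [B] and
   [J]. *)
have BBB : B *m (B *m B) = k *: ((27 * k) *: B + 6 *: (B *m B) + (96 * (129 * k)) *: J).
  by rewrite {1}BB -scalemxAr !mulmxDr -!scalemxAr BS BJ !scalerA.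
have trJ : \tr J = n%:R.
  rewrite /mxtrace; under eq_bigr do rewrite mxE.
  by rewrite sumr_const card_ord.
have trBB : \tr (B *m B) = 129 * k * n%:R.
  by rewrite BB mxtraceZ !mxtraceD !mxtraceZ trB trS trJ; ring.
pose rs : seq algC := [:: 129 * k; 9 * k; - 3 * k; 0].
have urs : uniq rs.
  rewrite /= !inE !(inj_eq (mulIf k0)) !mulf_eq0 (negPf k0) !orbF.
  have neq (a b : nat) : a != b -> (a%:R == b%:R :> algC) = false.
    by move=> ab; rewrite eqr_nat; apply: negPf.
  have neqN (a : nat) : (a%:R == - 3 :> algC) = false.
    by rewrite -addr_eq0 -natrD pnatr_eq0 addn_eq0 andbF.
  rewrite (neq 129 9)%N // (neq 129 0)%N // (neq 9 0)%N // oppr_eq0.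
  by rewrite (neq 3 0)%N // (neqN 129)%N (neqN 9)%N.
have annih : \big[mulmx/1%:M]_(r <- rs) (B - r%:M) = 0.
  rewrite !big_cons big_nil mulmx1 raddf0 subr0.
  (* The quadratic relation satisfied modulo [J] leaves a multiple of [J], and the last factor B -
     129 k kills [J]. *)
  have -> : (B - (9 * k)%:M) *m ((B - (- 3 * k)%:M) *m B) = (96 * 129 * k ^+ 2) *: J.
    rewrite mulmxBl mul_scalar_mx mulmxBl mul_scalar_mx mulmxBr -scalemxAr BBB BB.
    by apply/matrixP=> i j; rewrite !mxE; ring.
  by rewrite -scalemxAr mulmxBl mul_scalar_mx BJ subrr scaler0.
have [P [d [uP eB d_rs]]] := diagonalize_annihilated _ _ _ urs annih.
pose s := [seq d 0 i | i : 'I_n].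
have s_rs : {subset s <= rs} by move=> _ /mapP[i _ ->].
have sumE g : \sum_i g (d 0 i) = \sum_(r <- rs) (count_mem r s)%:R * g r :> algC.
  by rewrite -big_count // big_map big_enum.
have BBE := diagonalized_mulmx _ P d d uP; rewrite -eB in BBE.
have sum1 : \sum_i d 0 i = n%:R by rewrite -trB eB mxtrace_diagonalized.
have sum2 : \sum_i d 0 i * d 0 i = 129 * k * n%:R.
  by rewrite -trBB BBE mxtrace_diagonalized //; apply: eq_bigr => i _; rewrite mxE.
move: sum1 sum2; rewrite (sumE id) (sumE (fun x => x * x)).
have := sumE (fun=> 1); rewrite sumr_const card_ord.
have nR : n%:R = 165 * k :> algC by rewrite nE natrM.
rewrite nR !big_cons !big_nil; have := perm_flatten_count _ _ _ urs s_rs.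
have := spectrum_shift _ _ _ _ 1 uP eB; rewrite -/s /rs [flatten _]/=.
move: (count_mem _ s) (count_mem _ s) (count_mem _ s) (count_mem _ s) => m4 m3 m2 m1.
rewrite cats0 => specE sE e0 e1 e2.
(* As m1, m2, m3 are natural numbers, the two traces determine them. *)
have {}e1 : (43 * m1 + 3 * m2 = 55 + m3)%N.
  apply/eqP; rewrite -(eqr_nat algC); apply/eqP.
  apply: (mulIf k0); apply: (@mulIf _ 3); first by rewrite pnatr_eq0.
  by apply: (eq_of_sub e1); ring.
have {}e2 : (1849 * m1 + 9 * m2 + m3 = 2365)%N.
  apply/eqP; rewrite -(eqr_nat algC); apply/eqP.
  apply: (mulIf k0); apply: (mulIf k0); apply: (@mulIf _ 9); first by rewrite pnatr_eq0.
  by apply: (eq_of_sub e2); ring.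
have {}e0 : (m1 + m2 + m3 + m4 = 165 * q)%N.
  by apply/eqP; rewrite -(eqr_nat algC) natrM -/k; apply/eqP/(eq_of_sub (esym e0)); ring.
(* The second equation forces m1 <= 1. If m1 = 0, then m3 = 550 and 3 m2 = 605, which is impossible;
   m1 = 1 leaves m3 = 120 and m2 = 44. *)
have [m1E m2E m3E] : [/\ m1 = 1, m2 = 44 & m3 = 120]%N by split; lia.
have m4E : m4 = (165 * (q - 1))%N by lia.
have mapE : [seq d 0 i - 1 | i : 'I_n] = [seq x - 1 | x <- s] by rewrite -map_comp.
rewrite mapE in specE; apply: (perm_trans specE); move: (perm_map (fun x => x - 1) sE).
by rewrite m1E m2E m3E m4E !map_cat !map_nseq sub0r.
Qed.

(** * Hermitian spaces over the field with four elements *)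

(** Translating the summation variable by [c] multiplies the sum by [g c], which differs from 1. *)
Lemma sum_nontrivial_character (T : finZmodType) (g : T -> int) (c : T) :
  {morph g : x y / x + y >-> x * y} -> g c != 1 -> \sum_x g x = 0.
Proof.
move=> gD gc; have : \sum_x g x = g c * \sum_x g x.
  by rewrite mulr_sumr (reindex_inj (addrI c)); apply: eq_bigr => x _; rewrite gD.
by move/eqP; rewrite -subr_eq0 -{1}[\sum_x _]mul1r -mulrBl mulf_eq0 subr_eq0
  eq_sym (negPf gc) => /eqP.
Qed.

Lemma card_sum_int (T : finType) (P : pred T) :
  #|[set x | P x]|%:Z = \sum_x (P x)%:R.
Proof.
rewrite -sum1dep_card big_mkcond (big_morph Posz PoszD (erefl _)) /=.
by apply: eq_bigr => x _; case: (P x).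
Qed.

(** * Additive characters of the field with four elements *)

Section FieldOfOrderFour.
Variable F : finFieldType.
Hypothesis cardF : #|F| = 4%N.
Implicit Types a b c : F.

Lemma addrr4 a : a + a = 0.
Proof. exact: (addrr_pchar2 (card4_pchar cardF)). Qed.

Lemma expr4 a : a ^+ 4 = a.
Proof. by rewrite -cardF expf_card. Qed.

Lemma exprD4 a b : (a + b) ^+ 2 = a ^+ 2 + b ^+ 2.
Proof. by rewrite -(pFrobenius_autE (card4_pchar cardF)) rmorphD. Qed.

Lemma conj4E a : conj4 cardF a = a ^+ 2.
Proof. by []. Qed.

Lemma expr3_eq1 a : a != 0 -> a ^+ 3 = 1.
Proof. by move=> a0; apply: (mulfI a0); rewrite -exprS expr4 mulr1. Qed.

Lemma sqr_eq_self a : a ^+ 2 = a -> a = 0 \/ a = 1.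
Proof.
move/eqP; rewrite -subr_eq0 expr2 -{3}[a]mulr1 -mulrBr mulf_eq0 subr_eq0.
by case/orP=> /eqP; [left | right].
Qed.

(** This is (-1)^a for [a] in the prime subfield {0, 1}; the value -1 elsewhere carries no
    meaning. *)
Definition sign2 a : int := if a == 0 then 1 else -1.

Lemma sign2D a b : a ^+ 2 = a -> b ^+ 2 = b -> sign2 (a + b) = sign2 a * sign2 b.
Proof.
by move=> /sqr_eq_self[]-> /sqr_eq_self[]->;
  rewrite /sign2 ?addr0 ?add0r ?addrr4 ?eqxx ?oner_eq0.
Qed.

(** The additive character (-1)^Tr(a), where Tr(a) = a + a^2 is the trace to the prime subfield. *)
Definition trace_char a : int := sign2 (a + a ^+ 2).

Lemma trace4_sqr a : (a + a ^+ 2) ^+ 2 = a + a ^+ 2.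
Proof. by rewrite exprD4 -exprM expr4 addrC. Qed.

Lemma trace_charD : {morph trace_char : a b / a + b >-> a * b}.
Proof.
by move=> a b; rewrite /trace_char exprD4 addrACA (sign2D (a + _)) ?trace4_sqr.
Qed.

Lemma trace_char0 : trace_char 0 = 1.
Proof. by rewrite /trace_char expr0n addr0 /sign2 eqxx. Qed.

Lemma trace_char_nontrivial : exists c, trace_char c != 1.
Proof.
(* The trace c (1 + c) vanishes only at 0 and 1. *)
suff [c c01] : exists c, c \notin [set 0; 1 : F].
  exists c; rewrite /trace_char /sign2; case: ifP => //.
  rewrite -{1}[c]mulr1 expr2 -mulrDr mulf_eq0 => /orP[]/eqP c0; case/negP: c01.
    by rewrite c0 !inE eqxx.
  by rewrite -[c]add0r -(addrr4 1) -addrA c0 addr0 !inE eqxx orbT.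
apply/existsP; rewrite -negb_forall; apply/negP => /forallP all01.
have: (#|[set: F]| <= #|[set 0%R; 1%R : F]|)%N by apply/subset_leq_card/subsetP=> x _.
by rewrite cardsT cardF cards2; case: (_ != _).
Qed.

Lemma sum_trace_char a : \sum_c trace_char (c * a) = 4 * (a == 0)%:R.
Proof.
have [->|a0] := eqVneq.
  by under eq_bigr do rewrite mulr0 trace_char0; rewrite sumr_const cardF.
have [c nc] := trace_char_nontrivial.
apply: (@sum_nontrivial_character F _ (c / a)) => [x y|].
  by rewrite mulrDl trace_charD.
by rewrite divfK.
Qed.

End FieldOfOrderFour.

Arguments sign2 {F} a.
Arguments trace_char {F} a.

Section HermitianSpace.
Variable F : finFieldType.
Hypothesis cardF : #|F| = 4%N.
Variable f : {hermitian 'rV[F]_5 for false & conj4 cardF}.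
Hypothesis f_nondeg : nondegenerate f.
Implicit Types u v w x y : 'rV[F]_5.

Lemma form_swap x y : f x y = f y x ^+ 2.
Proof. by rewrite hermC expr0 mul1r conj4E. Qed.

Lemma form_swap_eq0 x y : (f x y == 0) = (f y x == 0).
Proof. by rewrite form_swap expf_eq0. Qed.

Lemma form_scaler a x y : f x (a *: y) = a ^+ 2 * f x y.
Proof. by rewrite linearZr_LR. Qed.

Lemma form_scalel a x y : f (a *: x) y = a * f x y.
Proof. by rewrite linearZl_LR. Qed.

Lemma form_nondeg y : y != 0 -> exists x, f x y != 0.
Proof.
move=> y0; have : y \notin orthov f fullv by rewrite (eqP f_nondeg) memv0.
by case/mem_orthovPn=> x _ yx; exists x; rewrite form_swap_eq0.
Qed.

Lemma norm_sqr x : f x x ^+ 2 = f x x.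
Proof. by rewrite -form_swap. Qed.

(** Polarization: the cross terms f(x, y) and f(y, x) = f(x, y)^2 add up to the trace of f(x, y). *)
Lemma sign_normD x y :
  sign2 (f (x + y) (x + y)) = sign2 (f x x) * sign2 (f y y) * trace_char (f x y).
Proof.
have -> : f (x + y) (x + y) = f x x + f y y + (f x y + f x y ^+ 2).
  by rewrite linearDl !linearDr /= (form_swap y x); ring.
rewrite (sign2D _ cardF (_ + _)) ?trace4_sqr //; last by rewrite exprD4 // !norm_sqr.
by rewrite (sign2D _ cardF) ?norm_sqr.
Qed.

Lemma sum_form_char y :
  \sum_x trace_char (f x y) = 1024 * (y == 0)%:R.
Proof.
have [->|y0] := eqVneq.
  under eq_bigr do rewrite linear0r trace_char0.
  by rewrite sumr_const card_mx cardF.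
have [c nc] := trace_char_nontrivial _ cardF.
have [x fx] := form_nondeg _ y0.
apply: (@sum_nontrivial_character _ _ (c / f x y *: x)) => [u v|].
  by rewrite linearDl (trace_charD _ cardF).
by rewrite form_scalel divfK.
Qed.

(** * The Gauss sum and the number of isotropic vectors *)

Definition gauss_sum : int := \sum_x sign2 (f x x).

(** Completing the square: substitute x + y for x. The two factors [trace_char (f x y)] cancel, and
    [f y y] has trace 0 because it lies in the prime subfield. *)
Lemma gauss_sum_shift y :
  \sum_x sign2 (f x x) * trace_char (f x y) = sign2 (f y y) * gauss_sum.
Proof.
rewrite /gauss_sum (reindex_inj (addIr y)) mulr_sumr; apply: eq_bigr => x _.
rewrite sign_normD linearDl /= (trace_charD _ cardF).
have -> : trace_char (f y y) = 1 by rewrite /trace_char norm_sqr addrr4 // /sign2 eqxx.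
have : trace_char (f x y) * trace_char (f x y) = 1.
  by rewrite /trace_char /sign2; case: ifP.
by move=> e; rewrite mulr1 -!mulrA e mulr1 mulrC.
Qed.

Lemma gauss_sum_sqr : gauss_sum ^+ 2 = 1024.
Proof.
rewrite expr2 {2}/gauss_sum mulr_sumr.
(* Each product of the whole sum with one of its terms becomes a shifted sum; after exchanging the
   summations, the inner character sum survives only at 0. *)
under eq_bigr do rewrite mulrC -gauss_sum_shift.
rewrite exchange_big /=; under eq_bigr do rewrite -mulr_sumr.
under eq_bigr => x _.
  under eq_bigr => y _.
    have -> : trace_char (f x y) = trace_char (f y x).
      by rewrite /trace_char form_swap -exprM expr4 // addrC.
    over.
  rewrite sum_form_char; over.
rewrite (bigD1 0) //= big1 => [|x /negPf->]; last by rewrite !mulr0.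
by rewrite linear0l eqxx addr0 /sign2 eqxx.
Qed.

(* As an isotropic point is determined by its transvection, the fibers of this  *)
(* map stand for the points, which saves a projective space.                    *)
Definition transvection_part v : {ffun 'rV[F]_5 -> 'rV[F]_5} :=
  [ffun x => f x v *: v].

(** Scaling by [a] multiplies f(x, v) v by a^2 a = a^3 = 1. *)
Lemma transvection_partZ a v :
  a != 0 -> transvection_part (a *: v) = transvection_part v.
Proof.
move=> a0; apply/ffunP=> x; rewrite !ffunE form_scaler scalerA mulrAC -exprSr.
by rewrite expr3_eq1 // mul1r.
Qed.

Lemma transvection_part_eq v w : v != 0 ->
  transvection_part w = transvection_part v -> exists2 a, a != 0 & w = a *: v.
Proof.
move=> v0 /ffunP eq_vw; have [x fxv] := form_nondeg _ v0.
have := eq_vw x; rewrite !ffunE => eqx.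
have fxw : f x w != 0.
  apply: contra_neq v0 => fxw0; apply: (scalerI fxv).
  by rewrite -eqx fxw0 !scale0r scaler0.
exists (f x v / f x w); first by rewrite mulf_neq0 ?invr_eq0.
by apply: (scalerI fxw); rewrite eqx scalerA mulrC divfK.
Qed.

Lemma card_transvection_fiber v : v != 0 ->
  #|[set w | transvection_part w == transvection_part v]| = 3%N.
Proof.
move=> v0; transitivity #|[set~ (0 : F)]|; last by rewrite cardsC1 cardF.
rewrite -(card_imset (mem [set~ 0]) (f := fun a => a *: v)); last first.
  by move=> a b /eqP; rewrite -subr_eq0 -scalerBl scaler_eq0 (negPf v0) orbF subr_eq0 => /eqP.
congr #|pred_of_set _|; apply/setP=> w; rewrite inE; apply/eqP/imsetP.
  by case/(transvection_part_eq _ _ v0)=> a a0 ->; exists a; rewrite ?inE.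
by case=> a; rewrite !inE => a0 ->; apply: transvection_partZ.
Qed.

Definition isotropic v := (v != 0) && (f v v == 0).

Lemma isotropicZ a v : a != 0 -> isotropic (a *: v) = isotropic v.
Proof.
by move=> a0; rewrite /isotropic scaler_eq0 form_scalel form_scaler !mulf_eq0 (negPf a0).
Qed.

(** The isotropic vectors fall into fibers of [transvection_part], each consisting of the three
    nonzero multiples of one vector. *)
Lemma dvd3_isotropic : (3 %| #|[set v | isotropic v]|)%N.
Proof.
rewrite -sum1_card (partition_big_imset transvection_part) /=.
apply: dvdn_sum => g /imsetP[v]; rewrite inE => iv ->.
rewrite sum1dep_card; have v0 : v != 0 by case/andP: iv.
rewrite (_ : #|_| = 3%N) // -[RHS](card_transvection_fiber v) //.
apply: eq_card => w; rewrite !inE andb_idl // => /eqP /(transvection_part_eq _ _ v0)[a a0 ->].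
by rewrite isotropicZ.
Qed.

Lemma card_norm0 : #|[set v | f v v == 0]| = #|[set v | isotropic v]|.+1.
Proof.
rewrite (cardsD1 0) inE linear0l eqxx; congr _.+1.
by apply: eq_card => v; rewrite !inE.
Qed.

(* The square root of 1024 is pinned down by divisibility of 495, and not of *)
(* 527, by 3. *)
Lemma gauss_sumE : gauss_sum = -32 /\ #|[set v | isotropic v]| = 495%N.
Proof.
have e : gauss_sum = 2 * #|[set v | f v v == 0]|%:Z - 1024.
  rewrite card_sum_int.
  rewrite -[1024](_ : \sum_(v : 'rV[F]_5) 1 = _); last first.
    by rewrite sumr_const card_mx cardF.
  rewrite mulr_sumr -sumrB; apply: eq_bigr => v _.
  by rewrite /sign2; case: eqP.
have /eqP := gauss_sum_sqr; rewrite (_ : 1024 = 32 ^+ 2) // eqf_sqr e card_norm0.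
by have /dvdnP[k ->] := dvd3_isotropic; case/orP=> /eqP; lia.
Qed.

(** * Isotropic vectors orthogonal to given isotropic vectors *)

Lemma sum_trace_char_form x v :
  \sum_a trace_char (f x (a ^+ 2 *: v)) = 4 * (f x v == 0)%:R.
Proof.
(* The squared scalar undoes the semilinearity of [f] in its second argument, since a^4 = a. *)
by rewrite -(sum_trace_char _ cardF); apply: eq_bigr => a _;
  rewrite form_scaler -exprM expr4.
Qed.

(* Expand the three conditions in additive characters: the sums over [x] are   *)
(* then complete Gauss sums.                                                    *)
Lemma card_isotropic_ortho v w :
  f v v = 0 -> f w w = 0 ->
  32 * #|[set x | [&& f x x == 0, f x v == 0 & f x w == 0]]|%:Z =
    \sum_a \sum_b (1024 * (a ^+ 2 *: v + b ^+ 2 *: w == 0)%:R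
                   - 32 * trace_char (b * (a ^+ 2 * f v w))).
Proof.
move=> fv fw; rewrite card_sum_int mulr_sumr.
(* The factor 32 is 2 * 4 * 4: 1 + [sign2 (f x x)] is twice the indicator of f(x, x) = 0, and the
   sums over [a] and [b] are 4 times the indicators of orthogonality to [v] and [w]. *)
transitivity (\sum_x \sum_a \sum_b (trace_char (f x (a ^+ 2 *: v + b ^+ 2 *: w))
    + sign2 (f x x) * trace_char (f x (a ^+ 2 *: v + b ^+ 2 *: w)))).
  apply: eq_bigr => x _.
  under [RHS]eq_bigr => a _.
    under eq_bigr => b _.
      rewrite -[X in X + _]mul1r -mulrDl linearDr (trace_charD _ cardF) mulrA; over.
    rewrite -mulr_sumr sum_trace_char_form mulrAC; over.
  rewrite -mulr_sumr sum_trace_char_form /sign2.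
  by case: (f x x == 0); case: (f x v == 0); case: (f x w == 0).
rewrite exchange_big; apply: eq_bigr => a _.
rewrite exchange_big; apply: eq_bigr => b _.
rewrite big_split /= sum_form_char gauss_sum_shift; congr (_ + _).
rewrite (proj1 gauss_sumE) sign_normD !form_scalel !form_scaler fv fw !mulr0.
rewrite {1 2}/sign2 eqxx !mul1r mulrC mulNr -!exprM expr4 //.
by congr (- (_ * trace_char _)); ring.
Qed.

Lemma sum_trace_char_form2 v w :
  \sum_a \sum_b trace_char (b * (a ^+ 2 * f v w)) =
    if f v w == 0 then 16 else 4.
Proof.
under eq_bigr do rewrite (sum_trace_char _ cardF) mulf_eq0 expf_eq0 /=.
case: ifP => _; first by under eq_bigr do rewrite orbT; rewrite sumr_const cardF.
by rewrite (bigD1 0) //= eqxx big1 // => a /negPf->.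
Qed.

Lemma sum_free_relations v w :
  (forall a b, a *: v + b *: w = 0 -> a = 0 /\ b = 0) ->
  \sum_a \sum_b (a ^+ 2 *: v + b ^+ 2 *: w == 0)%:R = 1 :> int.
Proof.
move=> free_vw; rewrite (bigD1 0) // /= [X in _ + X]big1 => [|a a0]; last first.
  apply: big1 => b _; case: eqP => // /free_vw[/eqP].
  by rewrite expf_eq0 (negPf a0).
rewrite addr0 (bigD1 0) // /= [X in _ + X]big1 => [|b b0]; last first.
  by case: eqP => // /free_vw[_ /eqP]; rewrite expf_eq0 (negPf b0).
by rewrite expr0n /= !scale0r !addr0 eqxx.
Qed.

Lemma sum_double_relations v : v != 0 ->
  \sum_a \sum_b (a ^+ 2 *: v + b ^+ 2 *: v == 0)%:R = 4 :> int.
Proof.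
move=> v0; rewrite [RHS](_ : _ = #|F|%:R); last by rewrite cardF.
rewrite -sumr_const; apply: eq_bigr => a _.
rewrite (bigD1 a) // /= [X in _ + X]big1 => [|b ba].
  by rewrite -scalerDl addrr4 // scale0r eqxx addr0.
rewrite -scalerDl scaler_eq0 (negPf v0) orbF -exprD4 // expf_eq0 /=.
by rewrite -(addrr4 _ cardF a) (inj_eq (addrI a)) (negPf ba).
Qed.

Lemma card_isotropic_ortho_sums v w :
  f v v = 0 -> f w w = 0 ->
  32 * #|[set x | [&& f x x == 0, f x v == 0 & f x w == 0]]|%:Z =
    1024 * (\sum_a \sum_b (a ^+ 2 *: v + b ^+ 2 *: w == 0)%:R)
    - 32 * (if f v w == 0 then 16 else 4).
Proof.
move=> fv fw; rewrite card_isotropic_ortho // -sum_trace_char_form2 !mulr_sumr.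
rewrite -sumrB; apply: eq_bigr => a _; rewrite !mulr_sumr -sumrB.
exact: eq_bigr.
Qed.

Lemma card_isotropic_ortho_free v w :
  f v v = 0 -> f w w = 0 ->
  (forall a b, a *: v + b *: w = 0 -> a = 0 /\ b = 0) ->
  #|[set x | [&& f x x == 0, f x v == 0 & f x w == 0]]| =
    if f v w == 0 then 16%N else 28%N.
Proof.
move=> fv fw free_vw; have := card_isotropic_ortho_sums _ _ fv fw.
by rewrite sum_free_relations //; case: ifP => _; lia.
Qed.

(** The count for two vectors at w = v, whence the repeated condition: 32 * 112 = 1024 * 4 - 32 *
    16. The zero vector is included. *)
Lemma card_isotropic_ortho1 v : isotropic v ->
  #|[set x | [&& f x x == 0, f x v == 0 & f x v == 0]]| = 112%N.
Proof.
case/andP=> v0 /eqP fv; have := card_isotropic_ortho_sums _ _ fv fv.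
by rewrite sum_double_relations // fv eqxx; lia.
Qed.

Lemma card_isotropic_nonortho v w : isotropic v -> isotropic w ->
  #|[set x | [&& isotropic x, f x v != 0 & f x w != 0]]| =
    if transvection_part v == transvection_part w then 384%N
    else if f v w == 0 then 288%N else 300%N.
Proof.
move=> iv iw; have [v0 fv] := andP iv; have [w0 fw] := andP iw.
(* Inclusion-exclusion; the zero vector contributes 1 - 1 - 1 + 1 = 0, so it may be counted
   throughout. *)
have iE : #|[set x | [&& isotropic x, f x v != 0 & f x w != 0]]|%:Z =
    #|[set x | f x x == 0]|%:Z
    - #|[set x | [&& f x x == 0, f x v == 0 & f x v == 0]]|%:Z
    - #|[set x | [&& f x x == 0, f x w == 0 & f x w == 0]]|%:Z
    + #|[set x | [&& f x x == 0, f x v == 0 & f x w == 0]]|%:Z.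
  rewrite !card_sum_int -!sumrB -big_split; apply: eq_bigr => x _ /=.
  rewrite /isotropic; have [->|x0] := eqVneq x 0; first by rewrite !linear0l eqxx.
  by case: (f x x == 0); case: (f x v == 0); case: (f x w == 0).
move: iE; rewrite card_norm0 !card_isotropic_ortho1 // (proj2 gauss_sumE).
have [eq_vw|neq_vw] := eqVneq.
  have [a a0 vE] := transvection_part_eq _ _ w0 eq_vw.
  have -> : [set x | [&& f x x == 0, f x v == 0 & f x w == 0]] =
            [set x | [&& f x x == 0, f x w == 0 & f x w == 0]].
    by apply/setP=> x; rewrite !inE vE form_scaler mulf_eq0 expf_eq0 (negPf a0).
  by rewrite card_isotropic_ortho1 //; lia.
rewrite card_isotropic_ortho_free ?(eqP fv) ?(eqP fw) //; first by case: ifP; lia.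
move=> a b; have [->|a0] := eqVneq a 0.
  by rewrite scale0r add0r => /eqP; rewrite scaler_eq0 (negPf w0) orbF => /eqP.
move/eqP; rewrite addr_eq0 -scaleNr => /eqP avbw; case/eqP: neq_vw.
have vE : v = (- b / a) *: w.
  by apply: (scalerI a0); rewrite avbw scalerA mulrC divfK.
rewrite vE transvection_partZ //; apply: contra_neq v0 => c0.
by rewrite vE c0 scale0r.
Qed.

(** * Transvections and their commutation *)

Section Transvections.
Implicit Types g : {'GL_5[F]}.

Lemma is_transvectionP g v :
  reflect (forall x, x *m GLval g = x + f x v *: v) (is_transvection f g v).
Proof. by apply: (iffP forallP) => tv x; apply/eqP/tv. Qed.

Lemma GLval_ext g g' : (forall x, x *m GLval g = x *m GLval g') -> g = g'.
Proof. by move=> e; apply/val_inj/row_matrixP=> i; rewrite !rowE e. Qed.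

Lemma transvection_exists v : f v v = 0 -> exists g, is_transvection f g v.
Proof.
(* In coordinates the transvection is the identity plus a matrix of rank at most one; it is its own
   inverse because f(v, v) = 0 and the characteristic is 2. *)
move=> fv; pose M := 1%:M + (\col_i f 'e_i v) *m v.
have ME x : x *m M = x + f x v *: v.
  rewrite mulmxDr mulmx1 mulmxA; congr (_ + _).
  have -> : x *m (\col_i f 'e_i v) = (f x v)%:M; last by rewrite mul_scalar_mx.
  rewrite {2}[x]row_sum_delta linear_sumlz; apply/matrixP=> i j.
  rewrite !ord1 !mxE mulr1n; apply: eq_bigr => k _.
  by rewrite linearZl_LR /= !mxE.
have MM : M *m M = 1%:M.
  apply/row_matrixP=> i; rewrite !rowE mulmxA !ME linearDl /= form_scalel fv mulr0 addr0.
  by rewrite -addrA -scalerDl addrr4 // scale0r addr0 mulmx1.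
have uM : M \is a GRing.unit by case/mulmx1_unit: MM.
by exists (FinRing.Unit uM); apply/is_transvectionP.
Qed.

Lemma transvection_eq g g' v w :
  is_transvection f g v -> is_transvection f g' w ->
  (g == g') = (transvection_part v == transvection_part w).
Proof.
move=> /is_transvectionP gv /is_transvectionP gw; apply/eqP/eqP => [eq_g|/ffunP eq_vw].
  by apply/ffunP=> x; rewrite !ffunE; apply: (addrI x); rewrite -gv -gw eq_g.
by apply: GLval_ext => x; rewrite gv gw; have := eq_vw x; rewrite !ffunE => ->.
Qed.

Lemma transvection_commute g g' v w : isotropic v -> isotropic w ->
  is_transvection f g v -> is_transvection f g' w ->
  commute g g' <-> f v w = 0.
Proof.
move=> /andP[v0 /eqP fv] /andP[w0 /eqP fw] /is_transvectionP gv /is_transvectionP gw.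
have ggE x : x *m GLval (g * g')%g =
    x + f x v *: v + f x w *: w + (f x v * f v w) *: w.
  by rewrite GL_MxE mulmxA gv gw linearDl /= form_scalel scalerDl addrA.
have g'gE x : x *m GLval (g' * g)%g =
    x + f x w *: w + f x v *: v + (f x w * f w v) *: v.
  by rewrite GL_MxE mulmxA gw gv linearDl /= form_scalel scalerDl addrA.
split=> [cgg|fvw].
  (* At [v] the two products differ by f(v, w) f(w, v) v. *)
  have := g'gE v; rewrite -cgg ggE fv !mul0r !scale0r !addr0 => /eqP.
  rewrite -subr_eq0 opprD addrA subrr sub0r oppr_eq0 scaler_eq0 (negPf v0) orbF.
  by rewrite mulf_eq0 [f w v == 0]form_swap_eq0 orbb => /eqP.
have fwv : f w v = 0 by apply/eqP; rewrite form_swap_eq0 fvw.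
by apply: GLval_ext => x; rewrite ggE g'gE fvw fwv !mulr0 !scale0r !addr0 addrAC.
Qed.

End Transvections.

(** * The blow-up of the graph on isotropic points *)

Section BlowUp.
Variables (n q : nat) (v : 'I_n -> 'rV[F]_5).
Hypothesis isotropic_v : forall i, isotropic (v i).
Hypothesis card_fiber : forall x, isotropic x ->
  #|[set i | transvection_part (v i) == transvection_part x]| = q.

Definition same_fiber (i j : 'I_n) : bool :=
  transvection_part (v i) == transvection_part (v j).
Definition linked (i j : 'I_n) : bool := f (v i) (v j) != 0.

Lemma transvection_part_isotropic x y : isotropic x ->
  transvection_part y = transvection_part x -> isotropic y.
Proof.
move=> ix /(transvection_part_eq _ _ (proj1 (andP ix)))[a a0 ->].
by rewrite isotropicZ.
Qed.

(** Double counting of the pairs (i, x) with [v i] and [x] on the same point: each [i] has 3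
    partners, each isotropic [x] has [q]. *)
Lemma card_fiber_sum (p : pred 'rV[F]_5) :
  (forall x y, isotropic x -> transvection_part y = transvection_part x -> p y = p x) ->
  (3 * #|[set i | p (v i)]| = q * #|[set x | isotropic x && p x]|)%N.
Proof.
move=> p_fiber; rewrite -2!sum1dep_card !big_distrr /=.
transitivity (\sum_(i | p (v i))
    \sum_(x | isotropic x && p x) (transvection_part (v i) == transvection_part x))%N.
  apply: eq_bigr => i pi; rewrite muln1.
  rewrite -[LHS](card_transvection_fiber _ (proj1 (andP (isotropic_v i)))).
  rewrite -sum1dep_card big_mkcond [RHS]big_mkcond; apply: eq_bigr => x _ /=.
  rewrite eq_sym; case: eqP => [e|_]; last by case: ifP.
  by rewrite (transvection_part_isotropic _ _ (isotropic_v i) (esym e))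
    (p_fiber _ _ (isotropic_v i)) ?pi.
rewrite exchange_big; apply: eq_bigr => x /andP[ix px]; rewrite muln1 /=.
rewrite -(card_fiber _ ix) -sum1dep_card big_mkcond [RHS]big_mkcond.
apply: eq_bigr => i _ /=; case: eqP => [e|_]; last by case: ifP.
by rewrite (p_fiber _ _ ix e) px.
Qed.

Lemma linked_fiber x y w : isotropic x ->
  transvection_part y = transvection_part x -> (f y w != 0) = (f x w != 0).
Proof.
move=> ix /(transvection_part_eq _ _ (proj1 (andP ix)))[a a0 ->].
by rewrite form_scalel mulf_eq0 (negPf a0).
Qed.

Lemma card_blowup : n = (165 * q)%N.
Proof.
have := card_fiber_sum predT (fun _ _ _ _ => erefl).
have -> : [set x | isotropic x && predT x] = [set x | isotropic x].
  by apply/setP=> x; rewrite !inE andbT.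
have -> : [set i | predT (v i)] = [set: 'I_n] by apply/setP=> x; rewrite !inE.
by rewrite (proj2 gauss_sumE) cardsT card_ord; lia.
Qed.

Lemma card_linked2 i j :
  #|[set k | linked k i && linked k j]| =
    if same_fiber i j then (128 * q)%N else
    if linked i j then (100 * q)%N else (96 * q)%N.
Proof.
have := card_fiber_sum (fun x => (f x (v i) != 0) && (f x (v j) != 0)).
rewrite card_isotropic_nonortho // /linked /same_fiber.
move=> h; have {h} := h (fun x y ix e => congr2 andb (linked_fiber _ _ _ ix e) (linked_fiber _ _ _ ix e)).
by case: eqP => // _; [|case: eqP => // _]; rewrite /=; lia.
Qed.

Lemma same_fiber_not_linked i j : same_fiber i j -> linked i j = false.
Proof.
move=> /eqP e; rewrite /linked (linked_fiber _ _ _ (isotropic_v j) e).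
by case/andP: (isotropic_v j) => _ ->.
Qed.

Lemma card_same_fiber j : #|[set k | same_fiber k j]| = q.
Proof. exact: card_fiber. Qed.

Lemma card_linked j : #|[set k | linked k j]| = (128 * q)%N.
Proof.
have := card_linked2 j j; rewrite /same_fiber eqxx => <-.
by apply: eq_card => k; rewrite !inE andbb.
Qed.

Lemma linkedC i j : linked i j = linked j i.
Proof. by rewrite /linked form_swap_eq0. Qed.

Lemma same_fiber_linked i j k : same_fiber i k -> linked k j = linked i j.
Proof. by move/eqP=> e; rewrite /linked (linked_fiber _ _ _ (isotropic_v k) e). Qed.

(** With the indices sorted by points, [fiber_mx] is the Kronecker product of I with the all-one
    matrix of size [q], and [linked_mx] is that of A0 with it. *)
Definition fiber_mx : 'M[algC]_n := \matrix_(i, j) (same_fiber i j)%:R.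
Definition linked_mx : 'M[algC]_n := \matrix_(i, j) (linked i j)%:R.

Lemma sum_bool_algC (p : pred 'I_n) : \sum_k (p k)%:R = #|[set k | p k]|%:R :> algC.
Proof.
rewrite -sum1dep_card natr_sum [RHS]big_mkcond.
by apply: eq_bigr => k _; case: (p k).
Qed.

Lemma fiber_mx_sqr : fiber_mx *m fiber_mx = q%:R *: fiber_mx.
Proof.
apply/matrixP=> i j; rewrite !mxE -[in RHS](card_same_fiber i) -sum_bool_algC mulr_suml.
apply: eq_bigr => k _; rewrite !mxE /same_fiber.
by rewrite [_ k == _ i]eq_sym; case: eqP => [->|_]; rewrite ?mul0r.
Qed.

Lemma fiber_linked_mx : fiber_mx *m linked_mx = q%:R *: linked_mx.
Proof.
apply/matrixP=> i j; rewrite !mxE -[in RHS](card_same_fiber i) -sum_bool_algC mulr_suml.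
apply: eq_bigr => k _; rewrite !mxE [same_fiber k i]eq_sym -/(same_fiber i k).
by have [/same_fiber_linked -> |] := boolP (same_fiber i k); rewrite ?mul0r.
Qed.

Lemma linked_mxT : linked_mx^T = linked_mx.
Proof. by apply/matrixP=> i j; rewrite !mxE linkedC. Qed.

Lemma fiber_mxT : fiber_mx^T = fiber_mx.
Proof. by apply/matrixP=> i j; rewrite !mxE /same_fiber eq_sym. Qed.

Lemma linked_fiber_mx : linked_mx *m fiber_mx = q%:R *: linked_mx.
Proof.
by apply: trmx_inj; rewrite trmx_mul linearZ /= linked_mxT fiber_mxT fiber_linked_mx.
Qed.

(** The strongly regular relation, scaled by [q]; the coefficients are 32 = 128 - 96, 4 = 100 - 96
    and 96. *)
Lemma linked_mx_sqr :
  linked_mx *m linked_mx =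
    q%:R *: (32 *: fiber_mx + 4 *: linked_mx + 96 *: const_mx 1).
Proof.
apply/matrixP=> i j; rewrite !mxE.
under eq_bigr do rewrite !mxE linkedC -natrM mulnb.
rewrite sum_bool_algC card_linked2.
have [/same_fiber_not_linked ->|_] := boolP (same_fiber i j).
  by rewrite natrM /=; ring.
by case: (linked i j); rewrite natrM /=; ring.
Qed.

Lemma fiber_mx_const : fiber_mx *m const_mx 1 = q%:R *: const_mx 1 :> 'M_n.
Proof.
apply/matrixP=> i j; rewrite !mxE -(card_same_fiber i) -sum_bool_algC mulr1.
by apply: eq_bigr => k _; rewrite !mxE mulr1 /same_fiber eq_sym.
Qed.

Lemma linked_mx_const : linked_mx *m const_mx 1 = (128 * q%:R) *: const_mx 1 :> 'M_n.
Proof.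
apply/matrixP=> i j; rewrite !mxE -natrM -(card_linked i) -sum_bool_algC mulr1.
by apply: eq_bigr => k _; rewrite !mxE mulr1 linkedC.
Qed.

Definition blowup_mx := fiber_mx + linked_mx.

Lemma blowup_mx_const : blowup_mx *m const_mx 1 = (129 * q%:R) *: const_mx 1 :> 'M_n.
Proof.
rewrite mulmxDl fiber_mx_const linked_mx_const -scalerDl.
by congr (_ *: _); ring.
Qed.

Lemma blowup_mx_spectrum : (0 < q)%N ->
  perm_eq (spectrum (blowup_mx - 1%:M))
    (129 * q%:R - 1 :: nseq 44 (9 * q%:R - 1) ++ nseq 120 (- 3 * q%:R - 1) ++
     nseq (165 * (q - 1)) (- 1)).
Proof.
move=> q0; have trS : \tr fiber_mx = n%:R.
  rewrite /mxtrace; under eq_bigr do rewrite mxE /same_fiber eqxx.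
  by rewrite sumr_const card_ord.
apply: (@blowup_spectrum _ _ _ fiber_mx) => //; first exact: card_blowup.
- rewrite mulmxDl !mulmxDr fiber_mx_sqr fiber_linked_mx linked_fiber_mx linked_mx_sqr.
  by apply/matrixP=> i j; rewrite !mxE; ring.
- by rewrite mulmxDl fiber_mx_sqr linked_fiber_mx -scalerDr.
- exact: blowup_mx_const.
rewrite mxtraceD trS -[RHS]addr0; congr (_ + _).
rewrite /mxtrace big1 // => i _; rewrite mxE same_fiber_not_linked //.
by rewrite /same_fiber.
Qed.

End BlowUp.

End HermitianSpace.

(** * The diagram *)

Section CosetAdjacency.
Import GroupScope.
Local Open Scope group_scope.

Lemma adjacent_or_eq (gT : finGroupType) (G N : {group gT}) (D : {set gT}) d e :
  three_transposition_group G D -> N <| G -> 3.-group N -> d \in D -> e \in D ->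
  adjacent d e || (d == e) =
    (coset N d == coset N e) || (coset N d * coset N e != coset N e * coset N d).
Proof.
case=> _ genD invD ordD nNG N3 dD eD.
have /subsetP sDN : D \subset 'N(N).
  by rewrite (subset_trans _ (normal_norm nNG)) // -genD subset_gen.
have [nd ne] := (sDN _ dD, sDN _ eD).
have sqr1 x : x \in D -> x * x = 1.
  by move=> xD; apply/eqP; rewrite -[x * x]/(x ^+ 2) -order_dvdn invD.
have sqrN x : x \in D -> coset N x * coset N x = 1.
  by move=> xD; rewrite -morphM ?sDN // sqr1 // morph1.
have inv x : x \in D -> x^-1 = x by move=> xD; apply/eqP; rewrite eq_invg_mul sqr1.
have deE : coset N (d * e) = coset N d * coset N e by rewrite morphM.
have ord_de := ordD _ _ dD eD.
rewrite /adjacent; have [eq_de|neq_de] /= := eqVneq (coset N d) (coset N e).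
  (* Modulo [N] the product is the square of an involution or of 1, so it lies in the 3-group [N]
     and cannot have order 2. *)
  have de_N : d * e \in N.
    by apply: coset_idr; rewrite ?groupM // deE -eq_de sqrN.
  move: ord_de (mem_p_elt N3 de_N); rewrite !inE => /or3P[]/eqP o_de; rewrite /p_elt o_de //.
  move=> _; move/eqP: o_de; rewrite order_eq1 -eq_invg_mul inv // => /eqP ->.
have -> : (d == e) = false by apply: contra_neqF neq_de => /eqP ->.
rewrite orbF; apply/eqP/idP => [o3|].
  apply: contra neq_de => /eqP com.
  have de3 : (d * e) ^+ 3 = 1 by apply/eqP; rewrite -order_dvdn o3.
  (* If the images commute, the cube of their product is the product itself; its triviality would
     make the cosets equal. *)
  have : (coset N d * coset N e) ^+ 3 = 1.
    by rewrite -deE -morphX ?groupM // de3 morph1.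
  rewrite expgMn // !expgS !expg0 !mulg1 !sqrN // !mulg1.
  by move/eqP; rewrite -eq_invg_mul -morphV // inv.
apply: contraNeq => n3.
have : (d * e) ^+ 2 == 1.
  by rewrite -order_dvdn; move: ord_de; rewrite !inE (negPf n3) orbF => /orP[]/eqP ->.
rewrite expgS expg1 -eq_invg_mul invMg !inv // => /eqP ed.
by rewrite -!morphM // ed.
Qed.
End CosetAdjacency.

Lemma diagram_coordinates (F : finFieldType) (cardF : #|F| = 4%N)
    (f : {hermitian 'rV[F]_5 for false & conj4 cardF})
    (gT : finGroupType) (G : {group gT}) (D : {set gT}) (h : nat) :
  three_transposition_group G D -> type_3_2h_2xSU5 f G D h ->
  exists v : 'I_#|D| -> 'rV[F]_5,
  [/\ forall i, isotropic F cardF f (v i),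
      forall x, isotropic F cardF f x ->
        #|[set i | transvection_part F cardF f (v i) == transvection_part F cardF f x]| =
          (3 ^ (2 * h))%N
    & forall i j, adjacent (enum_val i) (enum_val j) || (i == j) =
        same_fiber F cardF f _ v i j || linked F cardF f _ v i j].
Proof.
move=> GD [N [nNG N3 cardDN [phi [isoG phiD]]]].
have sDG : D \subset G by case: GD => _ <- _ _; apply: subset_gen.
have DG d : d \in D -> d \in G by apply/subsetP.
have NG d : d \in G -> d \in ('N(N))%g by apply/subsetP/normal_norm.
have inj_phi : {in (G / N)%g &, injective phi} by apply/injmP/(isom_inj isoG).
(* All values of [T] have first component [Zp1], so equality and commutation are decided by the
   transvections alone. *)
pose T d := phi (coset N d).
have TD d : d \in D -> T d \in two_x_SU5_class f.
  move=> dD; rewrite -phiD; apply: mem_morphim; first by rewrite mem_quotient ?DG.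
  by apply: mem_morphim => //; apply/NG/DG.
have Tex (i : 'I_#|D|) : exists v, [/\ (T (enum_val i)).1 = Zp1, isotropic F cardF f v
    & is_transvection f (T (enum_val i)).2 v].
  have := TD _ (enum_valP i); rewrite inE => /andP[/eqP T1 /existsP[v /and3P[v0 fv tv]]].
  by exists v; split=> //; apply/andP.
have [v vP] := fin_all_exists Tex.
have T_eq (i j : 'I_#|D|) : (T (enum_val i) == T (enum_val j)) = same_fiber F cardF f _ v i j.
  have [[i1 _ i2] [j1 _ j2]] := (vP i, vP j).
  by rewrite /same_fiber -(transvection_eq _ _ _ _ _ _ _ i2 j2) -pair_eqE /pair_eq i1 j1 eqxx.
exists v; split=> [i|x ix|i j]; first by case: (vP i).
  have [x0 /eqP fx] := andP ix.
  have [g gx] := transvection_exists _ cardF f _ fx.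
  (* The transvection of [x] comes from some [d] in [D], and the indices lying over the point of [x]
     enumerate the intersection of [D] with dN. *)
  have : (Zp1, g) \in two_x_SU5_class f.
    by rewrite inE eqxx; apply/existsP; exists x; rewrite x0 fx eqxx.
  rewrite -phiD => /morphimP[_ _ /morphimP[d _ dD ->] Td].
  have xE i : (transvection_part F cardF f (v i) == transvection_part F cardF f x)
      = (enum_val i \in d *: N)%g.
    have [[i1 _ i2] iD] := (vP i, enum_valP i).
    rewrite -(transvection_eq _ _ _ _ _ _ _ i2 gx).
    have -> : ((T (enum_val i)).2 == g) = (T (enum_val i) == phi (coset N d)).
      by rewrite -Td -pair_eqE /pair_eq i1 eqxx.
    rewrite (inj_in_eq inj_phi) ?mem_quotient ?DG //.
    rewrite -norm_rlcoset ?NG ?DG //.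
    by apply/eqP/idP => /rcoset_kercosetP; apply; rewrite ?NG ?DG.
  rewrite -(cardDN d dD) -sum1dep_card -[RHS]sum1_card (eq_bigl _ _ xE) big_mkcond /=.
  rewrite -(big_enum_val (fun y => if y \in (d *: N)%g then 1%N else 0%N)) -big_mkcondr.
  by apply: eq_bigl => y; rewrite !inE.
have [iD jD] := (enum_valP i, enum_valP j).
rewrite -(inj_eq enum_val_inj) (adjacent_or_eq _ G N D) //.
rewrite -(inj_in_eq inj_phi) ?mem_quotient ?DG // -/(T _) -/(T _) T_eq.
congr (_ || ~~ _).
have [[i1 ii i2] [j1 ij j2]] := (vP i, vP j).
have com := transvection_commute _ cardF f _ _ _ _ ii ij i2 j2.
rewrite -(inj_in_eq inj_phi) ?groupM ?mem_quotient ?DG // !morphM ?mem_quotient ?DG //.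
apply/eqP/eqP => [e|/com e].
  by apply/com; move: (congr1 snd e).
by rewrite -!/(T _); apply/eqP; rewrite -pair_eqE /pair_eq /= i1 j1 e !eqxx.
Qed.

Theorem proposition6p12 (F : finFieldType) (cardF : #|F| = 4%N)
    (f : {hermitian 'rV[F]_5 for false & conj4 cardF})
    (f_nondeg : nondegenerate f)
    (gT : finGroupType) (G : {group gT}) (D : {set gT}) (h : nat)
    (GD_3trans : three_transposition_group G D)
    (GD_type : type_3_2h_2xSU5 f G D h) :
  #|D| = (165 * 3 ^ (2 * h))%N /\
  has_diagram_spectrum D (129 * 3 ^ (2 * h) - 1)%N
    [:: (3 ^+ (2 * h + 2) - 1, 44%N); (- 3 ^+ (2 * h + 1) - 1, 120%N)]
    (- 1).
Proof.
have [v [iv card_v adjE]] :=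
  diagram_coordinates _ _ _ _ _ _ _ GD_3trans GD_type.
have cardD := card_blowup _ _ _ f_nondeg _ _ _ iv card_v.
have same_linked := same_fiber_not_linked _ _ _ f_nondeg _ _ iv.
have order_sqr d : d \in D -> #[d * d]%g = 1%N.
  case: GD_3trans => _ _ invD _ dD.
  by apply/eqP; rewrite order_eq1 -[(d * d)%g]/(d ^+ 2)%g -order_dvdn invD.
have adj_ii i : adjacent (enum_val i) (@enum_val _ (mem D) i) = false.
  by rewrite /adjacent order_sqr ?enum_valP.
have AE : adjacency_matrix D = blowup_mx F cardF f _ v - 1%:M.
  apply/matrixP=> i j; rewrite !mxE.
  have -> : (same_fiber F cardF f _ v i j)%:R + (linked F cardF f _ v i j)%:R =
      (same_fiber F cardF f _ v i j || linked F cardF f _ v i j)%:R :> algC.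
    have [/same_linked -> | _] := boolP (same_fiber F cardF f _ v i j).
      by rewrite addr0.
    by rewrite add0r.
  rewrite -adjE; have [->|_] := eqVneq i j.
    by rewrite adj_ii /= subrr.
  by rewrite orbF subr0.
set q := (3 ^ (2 * h))%N in cardD card_v *.
have q0 : (0 < q)%N by rewrite expn_gt0.
split=> //; split.
  move=> d dD; apply/eqP; rewrite -(eqr_nat algC) -sum1dep_card.
  pose i := enum_rank_in dD d.
  have iE : enum_val i = d by rewrite enum_rankK_in.
  (* The degree is the row sum 129 q of B = A + I, less the diagonal entry 1. *)
  have := congr1 (fun M : 'M_(_) => M i i) (blowup_mx_const _ _ _ f_nondeg _ _ _ iv card_v).
  rewrite -[blowup_mx _ _ _ _ _](subrK 1%:M) -AE mulmxDl mul1mx !mxE mulr1.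
  under [X in X + _]eq_bigr do rewrite !mxE mulr1 iE.
  rewrite -(big_enum_val (fun e => (adjacent d e)%:R)) => e.
  rewrite natrB ?muln_gt0 // natrM -e addrK natr_sum big_mkcondr.
  by apply/eqP/eq_bigr => y _; case: (adjacent d y).
(* The multiplicity of the eigenvalue 0 of B: 165 q less 1 + 44 + 120 = 165. *)
exists (165 * (q - 1))%N.
rewrite AE; apply: (perm_trans (blowup_mx_spectrum _ _ _ f_nondeg _ _ _ iv card_v q0)).
have E9 : 3 ^+ (2 * h + 2) = 9 * q%:R :> algC by rewrite natrX exprD; ring.
have E3 : 3 ^+ (2 * h + 1) = 3 * q%:R :> algC by rewrite natrX exprD; ring.
rewrite natrB ?muln_gt0 // natrM E9 E3 -mulNr /flatten /map /foldr cats0 -catA.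
exact: perm_refl.
Qed.
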